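(* Let $D_G$ be a weighted oriented graph with underlying graph $G$ on vertices $x_1,\ldots,x_n$. If $I(D_G)^{\vee}$ is Cohen-Macaulay (i.e. $K[x_1,\ldots,x_n]/I(D_G)^{\vee}$ is Cohen-Macaulay), then the complement graph $\overline G$ is chordal.
   Context: A weighted oriented graph $D_G$ with underlying simple graph $G$ is an orientation of the edges with weights $w(k)=w(x_k)\in\mathbb{Z}_{>0}$; $(x_i,x_j)$ denotes an edge oriented from $x_i$ to $x_j$; sources have weight $1$ by convention. $I(D_G)=\langle x_ix_j^{w(j)}:(x_i,x_j)\in E(D_G)\rangle\subseteq K[x_1,\ldots,x_n]$, $K$ a field. A graph is chordal if every induced cycle of length $\ge4$ has a chord. Alexander dual (Miller): for $\mathbf b\in\mathbb N^n$, $\mathbf m^{\mathbf b}=\langle x_i^{b_i}:b_i\ge1\rangle$; $\mathrm{Irr}(I)$ is the set of irreducible components in the irredundant irreducible decomposition of the monomial ideal $I$; $\mathbf a_I$ is the exponent vector of the lcm of the minimal generators of $I$; for $\mathbf 0\preceq\mathbf b\preceq\mathbf a$, $(\mathbf b^{\mathbf a})_i=a_i+1-b_i$ if $b_i\ge1$ and $0$ otherwise; $I^{\vee}=\langle\mathbf x^{\mathbf b^{\mathbf a_I}}:\mathbf m^{\mathbf b}\in\mathrm{Irr}(I)\rangle$. *)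

(* Defs.v *)
From mathcomp Require Import all_boot all_order all_algebra.
From mathcomp Require Import mpoly.
Set Implicit Arguments. Unset Strict Implicit. Unset Printing Implicit Defensive.
Import GRing.Theory.
Local Open Scope ring_scope.

Section Defs.
Variables (K : fieldType) (n : nat).
Local Notation R := {mpoly K[n]}.

Definition expv := {ffun 'I_n -> nat}.

Definition mono (a : 'I_n -> nat) : R := \prod_(i < n) 'X_i ^+ a i.

Definition is_ideal (I : R -> Prop) : Prop :=
  [/\ I 0, (forall f g, I f -> I g -> I (f + g)) & (forall r f, I f -> I (r * f))].

Definition ideal_gen (S : R -> Prop) : R -> Prop :=
  fun f => exists (m : nat) (g c : 'I_m -> R),
    (forall i, S (g i)) /\ f = \sum_(i < m) c i * g i.

Definition is_prime (P : R -> Prop) : Prop :=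
  [/\ is_ideal P, ~ P 1 & forall a b, P (a * b) -> P a \/ P b].

Definition ideal_add_seq (J : R -> Prop) (fs : seq R) : R -> Prop :=
  ideal_gen (fun x => J x \/ x \in fs).

(* Localization at a prime P, unfolded.  For the ring A = (R/J)_P:
   f_1,...,f_k (elements of P R_P, represented by numerators in P) is an
   A-regular sequence: each f_i is a non-zerodivisor on
   (R/(J+(f_1..f_{i-1})))_P and the final quotient (R/(J+(f_1..f_k)))_P is
   nonzero.  Here  x = 0  in (R/J')_P  iff  u x \in J' for some u \notin P. *)
Definition zero_loc (P J' : R -> Prop) (x : R) : Prop :=
  exists u, ~ P u /\ J' (u * x).

Definition loc_regular_seq (P J : R -> Prop) (fs : seq R) : Prop :=
  (forall f, f \in fs -> P f) /\
  (forall i, (i < size fs)%N ->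
     forall g, zero_loc P (ideal_add_seq J (take i fs)) (fs`_i * g) ->
               zero_loc P (ideal_add_seq J (take i fs)) g) /\
  ~ zero_loc P (ideal_add_seq J fs) 1.

Definition loc_depth (P J : R -> Prop) (d : nat) : Prop :=
  (exists fs, size fs = d /\ loc_regular_seq P J fs) /\
  (forall fs, loc_regular_seq P J fs -> (size fs <= d)%N).

(* a chain of primes Q_0 < Q_1 < ... < Q_k of length k with J <= Q_0 and
   Q_k <= P : primes of R containing J contained in P correspond to the
   primes of (R/J)_P *)
Definition prime_chain (P J : R -> Prop) (k : nat) : Prop :=
  exists Q : nat -> (R -> Prop),
    (forall i, (i <= k)%N -> is_prime (Q i)) /\
    (forall x, J x -> Q 0%N x) /\ (forall x, Q k x -> P x) /\
    (forall i, (i < k)%N ->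
       (forall x, Q i x -> Q i.+1 x) /\ exists x, Q i.+1 x /\ ~ Q i x).

Definition loc_dim (P J : R -> Prop) (d : nat) : Prop :=
  prime_chain P J d /\ (forall k, prime_chain P J k -> (k <= d)%N).

Definition cohen_macaulay_quot (J : R -> Prop) : Prop :=
  forall P, is_prime P -> (forall x, J x -> P x) ->
    exists d, loc_depth P J d /\ loc_dim P J d.

Definition mpow (b : 'I_n -> nat) : R -> Prop :=
  ideal_gen (fun f => exists i, (1 <= b i)%N /\ f = 'X_i ^+ b i).

Definition irr_decomp (I : R -> Prop) (S : seq expv) : Prop :=
  uniq S /\
  (forall f, I f <-> (forall b, b \in S -> mpow b f)) /\
  (forall b, b \in S ->
     ~ (forall f, (forall c, c \in S -> c != b -> mpow c f) -> I f)).

Definition min_mono_gen (I : R -> Prop) (a : 'I_n -> nat) : Prop :=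
  I (mono a) /\
  forall c : 'I_n -> nat, I (mono c) -> (forall i, (c i <= a i)%N) -> forall i, c i = a i.

Definition lcm_min_gens (I : R -> Prop) (a : 'I_n -> nat) : Prop :=
  (forall b, min_mono_gen I b -> forall i, (b i <= a i)%N) /\
  (forall i, a i = 0%N \/ exists b, min_mono_gen I b /\ b i = a i).

Definition bdual (a b : 'I_n -> nat) : 'I_n -> nat :=
  fun i => if (1 <= b i)%N then (a i + 1 - b i)%N else 0%N.

Definition alexander_dual (a : 'I_n -> nat) (S : seq expv) : R -> Prop :=
  ideal_gen (fun f => exists b, b \in S /\ f = mono (bdual a b)).

Definition edge_ideal (E : rel 'I_n) (w : 'I_n -> nat) : R -> Prop :=
  ideal_gen (fun f => exists i j, E i j /\ f = 'X_i * 'X_j ^+ w j).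

End Defs.

Definition weighted_oriented (n : nat) (E : rel 'I_n) (w : 'I_n -> nat) : Prop :=
  (forall i, ~~ E i i) /\ (forall i j, E i j -> ~~ E j i) /\
  (forall i, (0 < w i)%N) /\ (forall i, (forall j, ~~ E j i) -> w i = 1%N).

Definition underlying (n : nat) (E : rel 'I_n) : rel 'I_n :=
  fun i j => E i j || E j i.
Definition compl_graph (n : nat) (g : rel 'I_n) : rel 'I_n :=
  fun i j => (i != j) && ~~ g i j.

Definition cyc_adj (k : nat) (i j : 'I_k) : bool :=
  (val j == (val i).+1 %% k)%N || (val i == (val j).+1 %% k)%N.
Definition chordal (n : nat) (g : rel 'I_n) : Prop :=
  forall (k : nat) (c : 'I_k -> 'I_n), (4 <= k)%N -> injective c ->
    (forall i j : 'I_k, cyc_adj i j -> g (c i) (c j)) ->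
    exists i j : 'I_k, [/\ i != j, ~~ cyc_adj i j & g (c i) (c j)].

(* Main.v *)
(* Suppose the complement of G has a chordless cycle c_0, ..., c_(k-1), k >= 4,
   and localize at the prime P generated by the variables of the cycle.  The dual
   J lies in (x_i, x_j) for every edge ij of G, so the chain of variable ideals
   from (x_(c_0), x_(c_2)) up to P gives dimension at least k - 2, and
   Cohen-Macaulayness a regular sequence of that length.  Then the Koszul
   cohomology of R/J at P with respect to the powers y_j = x_(c_j)^N vanishes in
   degrees below k - 2.

   On the other hand, for N large, whether the product of the y_j over a set F
   of indices lies in J locally does not depend on the weights: it does as soon
   as the cycle vertices outside F are among two consecutive ones, and it does
   not when they contain an edge of G.  So simplicial cochains of the Alexander
   dual of the cycle give Koszul cochains, and the class in degree k - 3 dual to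
   the fundamental class of the cycle survives; this contradicts the vanishing. *)

Require Import Defs.
From HB Require Import structures.
From mathcomp Require Import all_boot all_order all_algebra.
From mathcomp Require Import mpoly.
From mathcomp Require Import zify ring.

Set Implicit Arguments.
Unset Strict Implicit.
Unset Printing Implicit Defensive.
Import GRing.Theory.
Local Open Scope ring_scope.

(** * Ordered Koszul cochains *)

Section OrderedKoszul.
Variables (A : comNzRingType) (T : eqType).
Implicit Types (x y : T -> A) (z w : seq T -> A) (s : seq T).

(* The Koszul differential on ordered, not necessarily alternating cochains:
   [kd y z s] is the sum over l of (-1)^l y_(s_l) z(s without its l-th entry).
   The recursive form makes contraction by [j] a homotopy by definition. *)
Fixpoint kd y z s : A :=
  if s is j :: s' then y j * z s' - kd y (fun t => z (j :: t)) s' else 0.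

Lemma kd_ext y z w s :
  (forall t, subseq t s -> (size t).+1 = size s -> z t = w t) ->
  kd y z s = kd y w s.
Proof.
elim: s z w => [//|j s IH] z w zw /=.
rewrite (zw s (subseq_cons _ _)) //; congr (_ - _); apply: IH => t ts szt.
by apply: zw => /=; rewrite ?eqxx ?szt.
Qed.

Lemma eq_kd y z w : z =1 w -> kd y z =1 kd y w.
Proof. by move=> zw s; apply: kd_ext. Qed.

Lemma kd0 y s : kd y (fun=> 0) s = 0.
Proof. by elim: s => //= j s ->; rewrite mulr0 subr0. Qed.

Lemma kdD y z w s : kd y (fun t => z t + w t) s = kd y z s + kd y w s.
Proof. by elim: s z w => [|j s IH] z w /=; rewrite ?addr0 ?IH; ring. Qed.

Lemma kdZ y a z s : kd y (fun t => a * z t) s = a * kd y z s.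
Proof. by elim: s z => [|j s IH] z /=; rewrite ?mulr0 ?IH; ring. Qed.

Lemma kdB y z w s : kd y (fun t => z t - w t) s = kd y z s - kd y w s.
Proof. by elim: s z w => [|j s IH] z w /=; rewrite ?subr0 ?IH; ring. Qed.

Lemma kd_sum (I : Type) (r : seq I) y (F : I -> seq T -> A) s :
  kd y (fun t => \sum_(i <- r) F i t) s = \sum_(i <- r) kd y (F i) s.
Proof.
elim: r => [|i r IH].
  by rewrite big_nil -[RHS](kd0 y s); apply: eq_kd => t; rewrite big_nil.
rewrite big_cons -IH -kdD; apply: eq_kd => t; exact: big_cons.
Qed.

Lemma kd_weight_sum (I : Type) (r : seq I) (y : I -> T -> A) z s :
  kd (fun j => \sum_(i <- r) y i j) z s = \sum_(i <- r) kd (y i) z s.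
Proof.
elim: s z => [|j s IH] z /=; first by rewrite big1.
by rewrite IH mulr_suml -sumrB.
Qed.

Lemma eq_kd_weight x y z s : x =1 y -> kd x z s = kd y z s.
Proof. by move=> xy; elim: s z => //= j s IH z; rewrite xy IH. Qed.

Lemma kd_anticomm x y z s : kd x (kd y z) s = - kd y (kd x z) s.
Proof.
elim: s z => [|j s IH] z /=; first by rewrite oppr0.
rewrite !(kdB, kdZ) IH; ring.
Qed.

(** [kd_anticomm] with equal weights only shows that twice this vanishes, which says nothing in
    characteristic 2; hence the separate induction. *)
Lemma kd_kd y z s : kd y (kd y z) s = 0.
Proof. by elim: s z => //= j s IH z; rewrite kdB kdZ IH; ring. Qed.

(** Multiplication by the product of the weights is a chain map from simplicial cochains (all
    weights 1) to Koszul cochains. *)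
Lemma kd_prod (y : T -> A) (phi : seq T -> A) s :
  kd y (fun t => phi t * \prod_(j <- t) y j) s =
  kd (fun=> 1) phi s * \prod_(j <- s) y j.
Proof.
elim: s phi => [|j s IH] phi /=; first by rewrite mul0r.
rewrite big_cons (eq_kd _ (w := fun t => y j * (phi (j :: t) * \prod_(i <- t) y i))).
  rewrite kdZ IH; ring.
by move=> t; rewrite big_cons; ring.
Qed.

End OrderedKoszul.

Lemma rmorph_kd (A B : comNzRingType) (T : eqType) (h : {rmorphism A -> B}) y z
    (s : seq T) :
  h (kd y z s) = kd (fun j => h (y j)) (fun t => h (z t)) s.
Proof. by elim: s z => [|j s IH] z /=; rewrite ?rmorph0 // rmorphB rmorphM IH. Qed.

(** * Signatures of ordered lists *)

Section Signature.
Variables (A : comNzRingType) (T : finType).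
Implicit Types (s r : seq T) (z : seq T -> A).

Definition chi (a : T) : T -> A := fun j => (j == a)%:R.

(* [altsign r s] is the signature of [s] as a permutation of [r], and 0 when
   the two lists of equal length are not permutations of each other. *)
Definition altsign r : seq T -> A :=
  foldr (fun a z => kd (chi a) z) (fun s => (s == [::])%:R) r.

Lemma kd_chi_notin a z s : a \notin s -> kd (chi a) z s = 0.
Proof.
elim: s z => //= j s IH z; rewrite inE negb_or /chi => /andP[aj as_].
by rewrite eq_sym (negbTE aj) mul0r IH // subr0.
Qed.

Lemma kd_chi_neq0 a z s :
  kd (chi a) z s != 0 ->
  a \in s /\ exists2 t, subseq t s & z t != 0.
Proof.
move=> nz; split.
  by apply: contraNT nz => /kd_chi_notin->.
elim: s z nz => [|j s IH] z /=; first by rewrite eqxx.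
have [z0|zn0 _] := eqVneq (z s) 0; last by exists s; first exact: subseq_cons.
rewrite z0 mulr0 sub0r oppr_eq0 => /IH[t ts zt].
by exists (j :: t); rewrite //= eqxx.
Qed.

Lemma altsign_neq0_mem r s a : altsign r s != 0 -> a \in r -> a \in s.
Proof.
elim: r s => //= b r IH s /kd_chi_neq0[bs [t ts nz]].
by rewrite inE => /orP[/eqP->//|/(IH _ nz)]; apply: mem_subseq.
Qed.

(** Anticommutativity moves [kd (chi a)] inward until it meets its own copy in the fold, where the
    square is zero. *)
Lemma kd_chi_altsign r s a : a \in r -> kd (chi a) (altsign r) s = 0.
Proof.
elim: r s => //= b r IH s; rewrite inE => /orP[/eqP->|ar].
  exact: kd_kd.
rewrite kd_anticomm -[RHS]oppr0; congr (- _).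
by rewrite -[RHS](kd0 (chi b) s); apply: eq_kd => t; apply: IH.
Qed.

(** The constant weight 1 is the sum of all [chi a], each of which kills [altsign r]. This
    closedness trades a coboundary in the last entries for a boundary in the first ones. *)
Lemma kd1_altsign r s : (forall a, a \in r) -> kd (fun=> 1) (altsign r) s = 0.
Proof.
move=> rT; rewrite (@eq_kd_weight _ _ _ (fun j => \sum_(a : T) chi a j)).
  by rewrite kd_weight_sum big1 // => a _; apply: kd_chi_altsign.
move=> j; rewrite (bigD1 j) //= /chi eqxx big1 ?addr0 // => i ij.
by rewrite eq_sym (negbTE ij).
Qed.

Lemma altsign_refl r : uniq r -> altsign r r = 1.
Proof.
elim: r => [//|a r IH] /=.
by case/andP=> ar /IH->; rewrite kd_chi_notin // /chi eqxx mulr1 subr0.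
Qed.

End Signature.

(** * The disc bounded by the cycle *)

Section Fan.
Variables (A : comNzRingType) (m : nat).
Local Notation T := 'I_m.+4.

Local Notation D := (altsign A (enum T)).

(* The triangles (0, i, i+1) fan out a disc bounded by the cycle; the degenerate
   ones contribute 0. *)
Definition fan (s : seq T) : A := \sum_(i : T) D [:: ord0, i, ordS i & s].

(** By closedness of [D] the coboundary becomes the boundary of the triangles. The rim edges (i,
    i+1) remain; the spokes cancel after reindexing by the cyclic shift. *)
Lemma kd1_fan s : kd (fun=> 1) fan s = \sum_(i : T) D [:: i, ordS i & s].
Proof.
rewrite kd_sum.
have E i : kd (fun=> 1) (fun t => D [:: ord0, i, ordS i & t]) s =
    D [:: i, ordS i & s] - D [:: ord0, ordS i & s] + D [:: ord0, i & s].
  have := kd1_altsign A [:: ord0, i, ordS i & s] (@mem_enum T predT).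
  by rewrite /= !mul1r !opprB => /eqP; rewrite addrCA addrA subr_eq0 => /eqP <-; ring.
rewrite (eq_bigr _ (fun i _ => E i)) big_split sumrB /=.
suff -> : \sum_i D [:: ord0, ordS i & s] = \sum_i D [:: ord0, i & s] by ring.
by rewrite [RHS](reindex (@ordS _)) //; apply: onW_bij; exists (@ord_pred _);
  [apply: ordSK | apply: ord_predK].
Qed.

Lemma enum_ord2 : exists2 r : seq T, enum T = [:: ord0, ordS ord0 & r] &
  (size r = m.+2)%N.
Proof.
exists (behead (behead (enum T))); last by rewrite !size_behead size_enum_ord.
have -> : ordS ord0 = lift ord0 ord0 :> T by apply: val_inj.
by rewrite enum_ordSl enum_ordSl.
Qed.

(** The list [r] misses exactly 0 and 1, so only a rim edge with these two ends contributes. The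
    edge i = 0 gives the signature of the identity; any other would need i = 1 and i + 1 = 0,
    impossible on at least four vertices. *)
Lemma kd1_fan_top r : enum T = [:: ord0, ordS ord0 & r] -> kd (fun=> 1) fan r = 1.
Proof.
move=> Er; rewrite kd1_fan (bigD1 ord0) //= -{1}Er altsign_refl ?enum_uniq //.
rewrite big1 ?addr0 // => i i0; apply/eqP; apply: contraTT isT => nz.
have mem j : j \in [:: i, ordS i & r] by apply: altsign_neq0_mem nz _; rewrite mem_enum.
have := enum_uniq T; rewrite Er /= inE negb_or => /andP[/andP[_ r0] /andP[r1 _]].
have := mem ord0; have := mem (ordS ord0).
rewrite !inE (negbTE r0) (negbTE r1) !orbF eq_sym => i1; rewrite eq_sym (negbTE i0) /=.
move/eqP/(congr1 (@ord_pred _)); rewrite ordSK => Ei; move: i1; rewrite -Ei.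
by rewrite ord_predK => /orP[]/eqP/(congr1 val) /=; rewrite !modn_small.
Qed.

End Fan.

(** * Vanishing from a regular sequence *)

Section Ideals.
Variables (K : fieldType) (n : nat).
Local Notation R := {mpoly K[n]}.
Implicit Types (I J P : R -> Prop).

Lemma idealB I x y : is_ideal I -> I x -> I y -> I (x - y).
Proof. by case=> _ ID IM Ix Iy; apply: ID => //; rewrite -mulN1r; apply: IM. Qed.

Lemma ideal_sum I (X : Type) (r : seq X) (F : X -> R) :
  is_ideal I -> (forall i, I (F i)) -> I (\sum_(i <- r) F i).
Proof.
case=> I0 ID _ IF; elim: r => [|i r IH]; first by rewrite big_nil.
by rewrite big_cons; apply: ID.
Qed.

Lemma ideal_gen_ideal (S : R -> Prop) : is_ideal (ideal_gen S).
Proof.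
split.
- by exists 0%N, (fun=> 0), (fun=> 0); split => [[]|] //; rewrite big_ord0.
- move=> _ _ [p [g [c [Sg ->]]]] [q [h [e [Sh ->]]]].
  pose glue (u : 'I_p -> R) (v : 'I_q -> R) i :=
    match split i with inl j => u j | inr j => v j end.
  exists (p + q)%N, (glue g h), (glue c e); split.
    by move=> i; rewrite /glue; case: split.
  rewrite big_split_ord /=.
  congr (_ + _); apply: eq_bigr => i _; rewrite /glue.
      by have -> : split (lshift q i) = inl i := unsplitK (inl i).
  by have -> : split (rshift p i) = inr i := unsplitK (inr i).
- move=> r _ [p [g [c [Sg ->]]]]; exists p, g, (fun i => r * c i); split=> //.
  by rewrite mulr_sumr; apply: eq_bigr => i _; rewrite mulrA.
Qed.

Lemma ideal_gen_incl (S : R -> Prop) x : S x -> ideal_gen S x.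
Proof. by move=> Sx; exists 1%N, (fun=> x), (fun=> 1); rewrite big_ord1 mul1r. Qed.

Lemma ideal_gen_min (S : R -> Prop) I :
  is_ideal I -> (forall x, S x -> I x) -> forall x, ideal_gen S x -> I x.
Proof.
move=> idI SI _ [p [g [c [Sg ->]]]]; apply: ideal_sum => // i.
by case: idI => _ _ IM; apply: (IM); apply: SI.
Qed.

Lemma prime_exclM P u v : is_prime P -> ~ P u -> ~ P v -> ~ P (u * v).
Proof. by case=> _ _ PM Pu Pv /PM[]. Qed.

Lemma prime_excl_prod P (X : Type) (r : seq X) (F : X -> R) :
  is_prime P -> (forall i, ~ P (F i)) -> ~ P (\prod_(i <- r) F i).
Proof.
move=> prP nF; elim: r => [|i r IH]; first by rewrite big_nil; case: prP.
by rewrite big_cons; apply: prime_exclM.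
Qed.

Lemma zero_loc_ideal P I : is_prime P -> is_ideal I -> is_ideal (zero_loc P I).
Proof.
move=> prP [I0 ID IM]; have P1 : ~ P 1 by case: prP.
split.
- by exists 1; rewrite mulr0.
- move=> f g [u [Pu Iu]] [v [Pv Iv]]; exists (u * v); split.
    exact: prime_exclM.
  have -> : u * v * (f + g) = v * (u * f) + u * (v * g) by ring.
  by apply: (ID); apply: (IM).
- move=> r f [u [Pu Iu]]; exists u; split=> //.
  by rewrite mulrCA; apply: (IM).
Qed.

Lemma zero_loc_incl P I x : is_prime P -> I x -> zero_loc P I x.
Proof. by case=> _ P1 _ Ix; exists 1; rewrite mul1r. Qed.

Lemma kd_ideal (T : eqType) I (y : T -> R) z s :
  is_ideal I -> (forall t, (size t).+1 = size s -> I (z t)) -> I (kd y z s).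
Proof.
move=> idI; elim: s z => [|j s IH] z Iz /=; first by case: idI.
apply: idealB => //; first by case: idI => _ _ IM; apply: (IM); apply: Iz.
by apply: IH => t sz; apply: Iz; rewrite /= sz.
Qed.

(** Only finitely many lists have a given length, so the product of their denominators serves them
    all. *)
Lemma common_denominator (T : finType) P I (x : seq T -> R) i :
  is_prime P -> is_ideal I ->
  (forall s, size s = i -> zero_loc P I (x s)) ->
  exists u, ~ P u /\ forall s, size s = i -> I (u * x s).
Proof.
move=> prP [_ _ IM] Zx.
have /fin_all_exists[u Hu] (t : i.-tuple T) : exists u, ~ P u /\ I (u * x t).
  by apply: Zx; apply: size_tuple.
exists (\prod_t u t); split; first by apply: prime_excl_prod => // t; case: (Hu t).
move=> s /eqP sz; rewrite (bigD1 (Tuple sz)) //= [u _ * _]mulrC -mulrA.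
by apply: (IM); case: (Hu (Tuple sz)).
Qed.

End Ideals.

Section Vanishing.
Variables (K : fieldType) (n : nat) (T : finType).
Local Notation R := {mpoly K[n]}.
Variables (P : R -> Prop) (y : T -> R) (d : nat) (I : nat -> R -> Prop) (f : nat -> R).
Hypothesis prP : is_prime P.
Hypothesis idI : forall m, is_ideal (I m).
Hypothesis IS : forall m x, (m < d)%N -> I m.+1 x -> exists r, I m (x - f m * r).
Hypothesis I_incl : forall m x, (m < d)%N -> I m x -> I m.+1 x.
Hypothesis If : forall m, (m < d)%N -> I m.+1 (f m).
Hypothesis f_reg : forall m g, (m < d)%N ->
  zero_loc P (I m) (f m * g) -> zero_loc P (I m) g.
Hypothesis f_nil : forall m, (m < d)%N ->
  exists M (g : T -> R), f m ^+ M = \sum_j g j * y j.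

Local Notation Z m := (zero_loc P (I m)).

Let idZ m : is_ideal (Z m). Proof. exact: zero_loc_ideal. Qed.

Let cocycle m i (z : seq T -> R) := forall s, size s = i.+1 -> Z m (kd y z s).

(** A single denominator [u] serves all lists, so [w] stays polynomial. In degree 0 [kd y w]
    vanishes on the empty list, and the condition says that [z [::]] is zero locally. *)
Let bounding m i (z : seq T -> R) :=
  exists u w, ~ P u /\ forall s, size s = i -> I m (u * z s - kd y w s).

Let bounding_zero_loc m i z u w :
  ~ P u -> (forall s, size s = i -> Z m (u * z s - kd y w s)) -> bounding m i z.
Proof.
move=> Pu Zw; have [v [Pv Iv]] := common_denominator prP (idI m) Zw.
exists (v * u), (fun t => v * w t); split=> [|s sz]; first exact: prime_exclM.
by rewrite kdZ -mulrA -mulrBr; apply: Iv.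
Qed.

(** Contraction by [j] turns [y j * z] minus a coboundary into [kd y z (j :: s)], which is locally
    zero; these are summed with the coefficients of [f m ^+ M]. *)
Let bounding_power m i z : (m < d)%N -> cocycle m i z ->
  exists M, bounding m i (fun s => f m ^+ M * z s).
Proof.
move=> md cz; have [M [g fM]] := f_nil md; exists M.
apply: (@bounding_zero_loc _ _ _ 1 (fun t => \sum_j g j * z (j :: t))) => [|s sz].
  by case: prP.
have -> : 1 * (f m ^+ M * z s) - kd y (fun t => \sum_j g j * z (j :: t)) s =
    \sum_j g j * kd y z (j :: s).
  rewrite mul1r fM kd_sum mulr_suml -sumrB; apply: eq_bigr => j _.
  rewrite kdZ /=; ring.
apply: ideal_sum => // j; case: (idZ m) => _ _ ZM; apply: (ZM); apply: cz.
by rewrite /= sz.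
Qed.

(** Since [f m] lies in [I m.+1], the bounding cochain [w] is a cocycle modulo [I m.+1]. By
    vanishing there, a multiple of [w] is a coboundary plus [f m * r] modulo [I m]; applying [kd]
    and cancelling [f m] shows that [r] bounds the lower power. *)
Let bounding_descent m i z M : (m < d)%N ->
  (forall w, cocycle m.+1 i w -> bounding m.+1 i w) ->
  bounding m i.+1 (fun s => f m ^+ M.+1 * z s) -> bounding m i.+1 (fun s => f m ^+ M * z s).
Proof.
move=> md vanish [u [w [Pu Iw]]].
have /vanish[u' [w' [Pu' Iw']]] : cocycle m.+1 i w.
  move=> s sz; apply: zero_loc_incl => //.
  have -> : kd y w s = u * f m ^+ M * z s * f m -
     (u * (f m ^+ M.+1 * z s) - kd y w s) by rewrite exprS; ring.
  apply: idealB => //; last by apply: I_incl => //; apply: Iw.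
  by case: (idI m.+1) => _ _ IM; apply: (IM); apply: If.
have /fin_all_exists[r Ir] (t : i.-tuple T) :
    exists r, I m (u' * w t - kd y w' t - f m * r).
  by apply: IS => //; apply: Iw'; apply: size_tuple.
(* The default 0 is harmless: on lists of length [i.+1], [kd] only evaluates [r'] at length [i]. *)
pose r' s := if insub s is Some t then r t else 0.
have {}Ir s : size s = i -> I m (u' * w s - kd y w' s - f m * r' s).
  by move=> /eqP sz; rewrite /r' insubT; apply: (Ir (Tuple sz)).
apply: (@bounding_zero_loc _ _ _ (u' * u) r') => [|s sz]; first exact: prime_exclM.
apply: f_reg => //; apply: zero_loc_incl => //.
have -> : f m * (u' * u * (f m ^+ M * z s) - kd y r' s) =
  u' * (u * (f m ^+ M.+1 * z s) - kd y w s) +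
  kd y (fun t => u' * w t - kd y w' t - f m * r' t) s.
  by rewrite !(kdB, kdZ) kd_kd exprS; ring.
case: (idI m) => _ ID IM; apply: (ID); first by apply: (IM); apply: Iw.
by apply: kd_ideal => // t; rewrite sz => -[]; apply: Ir.
Qed.

(* A power of [f m] acts as zero on cohomology by the contraction homotopy; the
   exponent is then lowered one step at a time, using that [f m] is regular
   and that cohomology modulo [I m.+1] vanishes one degree below. *)
Lemma koszul_vanishing i m (z : seq T -> R) :
  (m + i < d)%N ->
  (forall s, size s = i.+1 -> Z m (kd y z s)) ->
  exists u w, ~ P u /\ forall s, size s = i -> I m (u * z s - kd y w s).
Proof.
elim: i m z => [|i IH] m z mid cz; have md : (m < d)%N by lia.
  (* In degree 0 there are no coboundaries, so regularity alone removes the factors [f m]. *)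
  have [M] := bounding_power md cz; elim: M => [|M IHM] [u [w [Pu Iw]]].
    by exists u, w; split=> // s sz; have := Iw s sz; rewrite expr0 mul1r.
  apply: IHM; apply: (@bounding_zero_loc _ _ _ u (fun=> 0)) => // s sz.
  apply: f_reg => //; apply: zero_loc_incl => //; have := Iw s sz.
  case: s sz => //= _; rewrite !subr0 exprS.
  by have -> : u * (f m * f m ^+ M * z [::]) = f m * (u * (f m ^+ M * z [::])) by ring.
have [M] := bounding_power md cz; elim: M => [|M IHM].
  case=> u [w [Pu Iw]]; exists u, w.
  by split=> // s sz; have := Iw s sz; rewrite expr0 mul1r.
move=> bM; apply: IHM; apply: bounding_descent bM => // w cw.
by apply: IH => //; lia.
Qed.

End Vanishing.

(** * Variable primes and monomial ideals *)

Section VariablePrimes.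
Variables (K : fieldType) (n : nat).
Local Notation R := {mpoly K[n]}.
Implicit Types (V : pred 'I_n) (f g : R) (m : 'X_{1..n}).

Definition avoids V m := [forall v, V v ==> (m v == 0%N)].

Definition kill_vars V f : R :=
  f \mPo [tuple (if V i then 0 else 'X_i) | i < n].

HB.instance Definition _ V := GRing.RMorphism.copy (kill_vars V)
  (@comp_mpoly n K n [tuple (if V i then 0 else 'X_i) | i < n]).

(** The ideal generated by the variables in [V], taken as the kernel of an endomorphism of a domain
    so that primality is immediate. *)
Definition var_prime V f : Prop := kill_vars V f = 0.

Lemma avoidsP V m : reflect (forall v, V v -> m v = 0%N) (avoids V m).
Proof.
apply: (iffP forallP) => [H v Vv|H v]; first by have := H v; rewrite Vv => /eqP.
by apply/implyP=> /H ->.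
Qed.

Lemma kill_varsX V m : kill_vars V 'X_[m] = if avoids V m then 'X_[m] else 0.
Proof.
rewrite /kill_vars comp_mpolyX.
under eq_bigr => i _ do rewrite tnth_mktuple.
case: ifPn => [/avoidsP mV|].
  rewrite [RHS]mpolyXE_id; apply: eq_bigr => i _.
  by case: ifPn => // /mV ->; rewrite !expr0.
rewrite negb_forall => /existsP[v]; rewrite negb_imply => /andP[Vv mv].
by rewrite (bigD1 v) //= Vv expr0n (negbTE mv) mul0r.
Qed.

Lemma mcoeff_kill_vars V f m :
  (kill_vars V f)@_m = if avoids V m then f@_m else 0.
Proof.
rewrite /kill_vars comp_mpolyEX raddf_sum [f in RHS]mpolyE raddf_sum /=.
transitivity (\sum_(k <- msupp f)
    (if avoids V m then (f@_k *: 'X_[k])@_m else 0)); last first.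
  by case: ifP => // _; rewrite big1.
apply: eq_bigr => k _; rewrite -/(kill_vars V _) kill_varsX.
rewrite !mcoeffZ; case: (altP (k =P m)) => [<-|km].
  by case: ifP => // _; rewrite mcoeff0 mulr0.
have km0 : ('X_[k] : R)@_m = 0 by rewrite mcoeffX (negbTE km).
by do 2!case: ifP => _; rewrite ?km0 ?mcoeff0 mulr0.
Qed.

Lemma var_primeP V f : var_prime V f <-> forall m, avoids V m -> f@_m = 0.
Proof.
split=> [f0 m mV|H].
  by have := mcoeff_kill_vars V f m; rewrite f0 mV mcoeff0.
by apply/mpolyP => m; rewrite mcoeff_kill_vars mcoeff0; case: ifP => // /H.
Qed.

Lemma var_prime_prime V : is_prime (var_prime V).
Proof.
rewrite /var_prime; split.
- split; first exact: rmorph0.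
    by move=> f g Hf Hg; rewrite rmorphD /= Hf Hg addr0.
  by move=> r f Hf; rewrite rmorphM /= Hf mulr0.
- by rewrite rmorph1 => /eqP; rewrite oner_eq0.
- move=> a b; rewrite rmorphM /= => /eqP.
  by rewrite mulf_eq0 => /orP[]/eqP; [left|right].
Qed.

Lemma var_prime_ideal V : is_ideal (var_prime V).
Proof. by case: (var_prime_prime V). Qed.

Lemma var_primeX V m : var_prime V 'X_[m] <-> ~~ avoids V m.
Proof.
rewrite /var_prime kill_varsX; case: ifP => _; split=> // /eqP.
by rewrite -msupp_eq0 msuppX.
Qed.

Lemma var_prime_sub V V' f :
  (forall v, V v -> V' v) -> var_prime V f -> var_prime V' f.
Proof.
move=> sVV /var_primeP f0; apply/var_primeP => m /avoidsP mV.
by apply: f0; apply/avoidsP => v /sVV /mV.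
Qed.

Lemma not_var_prime V f :
  ~ var_prime V f -> exists2 m, avoids V m & f@_m != 0.
Proof.
move=> nf; have nz : kill_vars V f != 0 by apply/eqP.
have : mlead (kill_vars V f) \in msupp (kill_vars V f) by apply: mlead_supp.
rewrite mcoeff_msupp mcoeff_kill_vars; case: ifP => [mV fm|_]; last by rewrite eqxx.
by exists (mlead (kill_vars V f)).
Qed.

Lemma monoE (e : 'I_n -> nat) : mono K e = 'X_[[multinom e i | i < n]].
Proof. by rewrite mpolyXE_id; apply: eq_bigr => i _; rewrite mnmE. Qed.

Lemma mpolyX_dvd (e m : 'X_{1..n}) : (e <= m)%MM ->
  'X_[m] = 'X_[m - e] * 'X_[e] :> R.
Proof. by move=> em; rewrite -mpolyXD submK. Qed.

Lemma mcoeffMX_neq0 f (e m : 'X_{1..n}) : (f * 'X_[e])@_m != 0 -> (e <= m)%MM.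
Proof.
rewrite -mcoeff_msupp (perm_mem (msuppMX _ _)) => /mapP[k _ ->].
exact: lem_addr.
Qed.

Lemma monomial_ideal_mem (S : R -> Prop) (Q : 'X_{1..n} -> Prop) f m :
  (forall g, S g -> exists e, Q e /\ g = 'X_[e]) ->
  ideal_gen S f -> f@_m != 0 -> exists e, Q e /\ (e <= m)%MM.
Proof.
move=> SQ [p [g [c [Sg ->]]]]; rewrite raddf_sum /=.
case: (pickP (fun i => (c i * g i)@_m != 0)) => [i|z].
  by have [e [Qe ->]] := SQ _ (Sg i) => /mcoeffMX_neq0 em _; exists e.
by rewrite big1 ?eqxx // => i _; apply/eqP; have := z i => /negbFE.
Qed.

(* The radical of the ideal of the ['X_(c j) ^+ N] contains every variable of [V]. *)
Lemma var_prime_nilpotent (T : finType) V (c : T -> 'I_n) N f :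
  (forall v, V v -> exists j, c j = v) -> var_prime V f ->
  exists M (g : T -> R), f ^+ M = \sum_j g j * 'X_(c j) ^+ N.
Proof.
move=> Vc fV.
pose Y x := exists g : T -> R, x = \sum_j g j * 'X_(c j) ^+ N.
have YD x x' : Y x -> Y x' -> Y (x + x').
  case=> g -> [h ->]; exists (fun j => g j + h j).
  by rewrite -big_split; apply: eq_bigr => j _; rewrite mulrDl.
have YM r x : Y x -> Y (r * x).
  case=> g ->; exists (fun j => r * g j).
  by rewrite mulr_sumr; apply: eq_bigr => j _; rewrite mulrA.
have Y0 : Y 0 by exists (fun=> 0); rewrite big1 // => j _; rewrite mul0r.
have Yc j : Y ('X_(c j) ^+ N).
  exists (fun i => (i == j)%:R); rewrite (bigD1 j) //= eqxx mul1r big1 ?addr0 //.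
  by move=> i /negbTE ->; rewrite mul0r.
suff : exists M, Y (f ^+ M) by case=> M [g Hg]; exists M, g.
have radD x x' : (exists M, Y (x ^+ M)) -> (exists M, Y (x' ^+ M)) ->
    exists M, Y ((x + x') ^+ M).
  case=> M Yx [M' Yx']; exists (M + M')%N; rewrite exprDn.
  elim/big_rec: _ => // i z _ Yz; apply: YD Yz; rewrite -mulr_natl; apply: (YM).
  case: (leqP M' i) => iM; first by rewrite -(subnK iM) exprD; do 2!apply: (YM).
  have MM : (M <= M + M' - i)%N by lia.
  by rewrite mulrC -(subnK MM) exprD; do 2!apply: (YM).
(* Each monomial of [f] is divisible by a variable of [V], so its [N]-th power lies in [Y]; [radD]
   combines them. *)
rewrite (mpolyE f) big_seq; elim/big_rec: _ => [|m z].
  by exists 1%N; rewrite expr1.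
rewrite mcoeff_msupp => fm; apply: radD.
have : ~~ avoids V m.
  by apply: contraNN fm => mV; apply/eqP; move/var_primeP: fV; apply.
rewrite negb_forall => /existsP[v]; rewrite negb_imply => /andP[/Vc[j <-] mv].
have Um : (U_(c j) <= m)%MM.
  apply/mnm_lepP => i; rewrite mnm1E; case: eqP => // <-; by rewrite lt0n.
exists N; rewrite (mpolyX_dvd Um) scalerAl exprMn; exact: YM.
Qed.

End VariablePrimes.

(** * The Alexander dual of the edge ideal *)

Section EdgeIdealDual.
Variables (K : fieldType) (n : nat) (E : rel 'I_n) (w : 'I_n -> nat).
Variables (a : 'I_n -> nat) (S : seq (expv n)).
Hypothesis EwP : weighted_oriented E w.
Hypothesis aP : lcm_min_gens (@edge_ideal K n E w) a.
Hypothesis SP : irr_decomp (@edge_ideal K n E w) S.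
Local Notation R := {mpoly K[n]}.
Local Notation I := (@edge_ideal K n E w).
Local Notation J := (@alexander_dual K n a S).

Let edge_exp i j : 'X_{1..n} := (U_(i) + U_(j) *+ w j)%MM.

Let edge_expE i j v : edge_exp i j v = ((i == v) + (j == v) * w j)%N.
Proof. by rewrite mnmDE mulmnE !mnm1E. Qed.

Let edge_monoE i j : 'X_i * 'X_j ^+ w j = 'X_[edge_exp i j] :> R.
Proof. by rewrite mpolyXn -mpolyXD. Qed.

Let edge_ideal_edge i j : E i j -> I 'X_[edge_exp i j].
Proof. by move=> Eij; apply: ideal_gen_incl; exists i, j; rewrite edge_monoE. Qed.

Let edge_ideal_mem f m :
  I f -> f@_m != 0 -> exists i j, [/\ E i j, (0 < m i)%N & (w j <= m j)%N].
Proof.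
move=> If fm.
pose Q e := exists i j, E i j /\ e = edge_exp i j.
have [g [i [j [Eij ->]]]|_ [[i [j [Eij ->]]] /mnm_lepP em]] :=
    monomial_ideal_mem (Q := Q) _ If fm.
  by exists (edge_exp i j); split; [exists i, j | apply: edge_monoE].
exists i, j; split=> //.
  by apply: leq_trans (em i); rewrite edge_expE eqxx.
by apply: leq_trans (em j); rewrite edge_expE eqxx mul1n leq_addl.
Qed.

(** An edge has only one orientation, so no other generator is supported inside its two ends. Its
    monomial is thus a minimal generator and its exponents are bounded by [a]. *)
Lemma lcm_min_gens_edge i j : E i j -> (0 < a i)%N /\ (w j <= a j)%N.
Proof.
case: EwP => irrE [asymE [w0 _]] Eij.
have ij : (i == j) = false by apply: contraTF Eij => /eqP ->; apply: irrE.
have monoEe : mono K (edge_exp i j) = 'X_[edge_exp i j].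
  by rewrite monoE; congr 'X_[_]; apply/mnmP => v; rewrite mnmE.
have ai : min_mono_gen I (edge_exp i j); last first.
  have := (aP.1 _ ai i, aP.1 _ ai j).
  by rewrite !edge_expE !eqxx ij eq_sym ij mul1n !addn0 => -[].
split; first by rewrite monoEe; apply: edge_ideal_edge.
move=> c Ic cle.
have [p [q [Epq cp cq]]] : exists i j, [/\ E i j, (0 < c i)%N & (w j <= c j)%N].
  have := edge_ideal_mem (m := [multinom c i | i < n]) Ic.
  rewrite monoE mcoeffX eqxx oner_eq0 => /(_ isT)[p [q]].
  by rewrite !mnmE; exists p, q.
have pos v : (0 < c v)%N -> v = i \/ v = j.
  move=> cv; have := leq_trans cv (cle v); rewrite edge_expE.
  by case: eqP => [->|_]; [left | case: eqP => [->|_]; [right |]].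
have [Ep Eq] : p = i /\ q = j.
  case: (pos p cp) Epq => -> Epq; case: (pos q (leq_trans (w0 q) cq)) Epq => -> // Epq.
  - by case/negP: (irrE i).
  - by case/negP: (asymE _ _ Eij).
  - by case/negP: (irrE j).
move=> v; apply/eqP; rewrite eqn_leq cle edge_expE /=.
have [<-|_] := eqVneq i v; first by rewrite eq_sym ij addn0 -Ep.
by have [<-|_] := eqVneq j v; rewrite ?mul1n ?add0n // -Eq.
Qed.

Let edge_ideal_sub_component b f : b \in S -> I f -> mpow b f.
Proof. by case: SP => _ [IE _] bS /IE; apply. Qed.

(** Every component contains the edge monomial, hence has an exponent at [i] or [j] between 1 and
    the corresponding [a]. The dual exponent [a + 1 - b] there is positive. *)
Lemma alexander_dual_var_prime i j f :
  E i j -> J f -> var_prime (pred2 i j) f.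
Proof.
move=> Eij; apply: ideal_gen_min; first exact: var_prime_ideal.
move=> _ [b [bS ->]]; rewrite monoE; apply/var_primeX.
have [ai wj] := lcm_min_gens_edge Eij.
have := edge_ideal_sub_component bS (edge_ideal_edge Eij).
case/(monomial_ideal_mem (Q := fun e => exists l, (0 < b l)%N /\ e = (U_(l) *+ b l)%MM)
       (m := edge_exp i j)).
- by move=> _ [l [bl ->]]; exists (U_(l) *+ b l)%MM; split; [exists l | rewrite mpolyXn].
- by rewrite mcoeffX eqxx oner_eq0.
move=> _ [[l [bl ->]] /mnm_lepP/(_ l)]; rewrite mulmnE mnm1E eqxx mul1n edge_expE.
move=> bl_le.
have [lij bla] : pred2 i j l /\ (b l <= a l)%N.
  have ij : i != j by apply: contraTneq Eij => ->; case: EwP => irrE _; apply: irrE.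
  move: bl_le; rewrite /= !(eq_sym l); have [<-|_] := eqVneq i l.
    by rewrite eq_sym (negbTE ij); split=> //; lia.
  have [<-|_] := eqVneq j l; first by split=> //; lia.
  by rewrite leqNgt bl.
rewrite negb_forall; apply/existsP; exists l; rewrite lij mnmE /bdual bl /=.
by rewrite -lt0n subn_gt0 addn1 ltnS.
Qed.

(** If every component involved [i] or [j], a monomial in these two variables with large exponents
    would lie in all of them, hence in the edge ideal, and force an edge between [i] and [j]. *)
Lemma independent_component i j :
  ~~ underlying E i j -> exists2 b, b \in S & (b i = 0 /\ b j = 0)%N.
Proof.
case: EwP => irrE [_ [w0 _]]; rewrite negb_or => /andP[nEij nEji].
case: (boolP (has (fun b : expv n => (b i == 0) && (b j == 0))%N S)) => [/hasP|/hasPn nS].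
  by case=> b bS /andP[/eqP bi /eqP bj]; exists b.
(* [B] dominates every exponent at [i] and [j] occurring in [S]. *)
pose B := (\sum_(b <- S) (b i + b j))%N.
have bB b : b \in S -> (b i <= B)%N /\ (b j <= B)%N.
  by move=> bS; rewrite /B (big_rem b bS) /=; lia.
pose m := (U_(i) *+ B + U_(j) *+ B)%MM.
have mE v : m v = ((i == v) * B + (j == v) * B)%N by rewrite mnmDE !mulmnE !mnm1E.
have Im : I 'X_[m].
  case: SP => _ [IE _]; apply/IE => b bS.
  have [v bv vij] : exists2 v, (0 < b v)%N & (v == i) || (v == j).
    by have := nS b bS; rewrite negb_and -!lt0n => /orP[]; [exists i | exists j];
      rewrite ?eqxx ?orbT.
  have vm : (U_(v) *+ b v <= m)%MM.
    apply/mnm_lepP => u; rewrite mE mulmnE mnm1E; have [<-|] := eqVneq v u; last by [].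
    have [] := bB b bS; rewrite !(eq_sym _ v).
    by case/orP: vij => /eqP <-; rewrite eqxx; lia.
  rewrite (mpolyX_dvd _ vm) -mpolyXn.
  have [_ _ mpowM] := ideal_gen_ideal
    (fun f : R => exists i, (0 < b i)%N /\ f = 'X_i ^+ b i).
  by apply: (mpowM); apply: ideal_gen_incl; exists v.
have [|p [q [Epq]]] := edge_ideal_mem (m := m) Im.
  by rewrite mcoeffX eqxx oner_eq0.
rewrite !mE => mp /(leq_trans (w0 q)) mq.
have pos v : (0 < (i == v) * B + (j == v) * B)%N -> v = i \/ v = j.
  by case: eqP => [->|_]; [left | case: eqP => [->|_]; [right |]].
case: (pos p mp) Epq => -> Epq; case: (pos q mq) Epq => -> Epq.
- by case/negP: (irrE i).
- by case/negP: nEij.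
- by case/negP: nEji.
- by case/negP: (irrE j).
Qed.

(** A dual exponent is at most [a] on the support of [b] and 0 off it, so beyond the bound [a] only
    this support matters. *)
Lemma alexander_dual_mono (b : expv n) (m : 'X_{1..n}) : b \in S ->
  (forall v, b v != 0%N -> a v <= m v)%N -> J 'X_[m].
Proof.
move=> bS am; have bm : ([multinom bdual a b v | v < n] <= m)%MM.
  apply/mnm_lepP => v; rewrite mnmE /bdual.
  case: ifP => // bv; apply: leq_trans (am v _); last by rewrite -lt0n.
  by rewrite leq_subLR addnC leq_add2r.
rewrite (mpolyX_dvd _ bm); case: (ideal_gen_ideal
  (fun f : R => exists b, b \in S /\ f = mono K (bdual a b))) => _ _ JM.
by apply: (JM); apply: ideal_gen_incl; exists b; rewrite monoE.
Qed.

End EdgeIdealDual.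

(** * Chains of variable primes *)

Section VariableChain.
Variables (K : fieldType) (n k : nat) (c : 'I_k.+2 -> 'I_n).
Hypothesis c_inj : injective c.
Local Notation R := {mpoly K[n]}.

Lemma var_prime_chain (J : R -> Prop) a b :
  a != b -> (forall f, J f -> var_prime (pred2 (c a) (c b)) f) ->
  prime_chain (var_prime (mem (codom c))) J k.
Proof.
move=> ab Jab.
(* The chain starts with the variables at [a] and [b] and adds one at a time: [l.+2] variables at
   stage [l]. *)
pose e := [:: a, b & filter (predC (mem [:: a; b])) (enum 'I_k.+2)].
have e_uniq : uniq e.
  by rewrite /= !inE !mem_filter /= !inE !eqxx !orbT !orbF ab filter_uniq ?enum_uniq.
have e_mem x : x \in e.
  by rewrite !inE mem_filter mem_enum andbT /= !inE; case: (x == a); case: (x == b).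
have e_size : size e = k.+2.
  have /perm_size -> : perm_eq e (enum 'I_k.+2).
    by apply: uniq_perm => // [|x]; rewrite ?enum_uniq // e_mem mem_enum.
  by rewrite size_enum_ord.
pose V l : pred 'I_n := fun v => v \in map c (take l.+2 e).
exists (fun l => var_prime (V l)); split; first by move=> *; apply: var_prime_prime.
split.
  move=> f /Jab; apply: var_prime_sub => v.
  by rewrite /V /= take0 !inE.
split.
  move=> f; apply: var_prime_sub => v /mapP[x _ ->]; exact: codom_f.
move=> i ik; split.
  move=> f; apply: var_prime_sub => v /mapP[x xt ->]; apply: map_f.
  by move: xt; rewrite [in X in _ -> X](take_nth a) ?e_size // mem_rcons inE => ->; rewrite orbT.
have nV : avoids (V i) U_(c (nth a e i.+2)).
  apply/avoidsP => v /mapP[x xt ->]; rewrite mnm1E (inj_eq c_inj).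
  case: eqP => // Ex; have := take_uniq i.+3 e_uniq.
  by rewrite (take_nth a) ?e_size // rcons_uniq Ex xt.
exists 'X_(c (nth a e i.+2)); split; last by move/var_primeX; rewrite nV.
have Vx : V i.+1 (c (nth a e i.+2)).
  by apply: map_f; rewrite (take_nth a) ?e_size // mem_rcons mem_head.
by apply/var_primeX/negP => /avoidsP/(_ _ Vx); rewrite mnm1E eqxx.
Qed.

End VariableChain.

(** * The Koszul class of the cycle *)

Section KoszulClass.
Variables (K : fieldType) (n k N : nat) (c : 'I_k.+4 -> 'I_n).
Hypothesis c_inj : injective c.
Local Notation R := {mpoly K[n]}.
Local Notation T := 'I_k.+4.
Local Notation P := (@var_prime K n (mem (codom c))).

Definition pow_exp (s : seq T) : 'X_{1..n} := (\sum_(j <- s) U_(c j) *+ N)%MM.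

Definition pow_var (j : T) : R := 'X_(c j) ^+ N.

Definition fan_cochain (s : seq T) : R := (fan K s)%:MP * \prod_(j <- s) pow_var j.

Lemma pow_exp_cons j s : pow_exp (j :: s) = (U_(c j) *+ N + pow_exp s)%MM.
Proof. exact: big_cons. Qed.

Lemma pow_exp_notin j s : j \notin s -> pow_exp s (c j) = 0%N.
Proof.
elim: s => [|i s IH]; first by rewrite /pow_exp big_nil mnm0E.
rewrite inE negb_or => /andP[ji /IH js].
by rewrite pow_exp_cons mnmDE js mulmnE mnm1E (inj_eq c_inj) eq_sym (negbTE ji).
Qed.

Lemma pow_exp_in j s : j \in s -> (N <= pow_exp s (c j))%N.
Proof.
elim: s => [//|i s IH]; rewrite inE pow_exp_cons mnmDE mulmnE mnm1E.
case/orP => [/eqP <-|/IH]; first by rewrite eqxx mul1n leq_addr.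
by move=> Nj; apply: leq_trans Nj (leq_addl _ _).
Qed.

Lemma prod_pow_var s : \prod_(j <- s) pow_var j = 'X_[pow_exp s].
Proof.
elim: s => [|j s IH]; first by rewrite /pow_exp !big_nil mpolyX0.
by rewrite big_cons IH pow_exp_cons mpolyXD /pow_var mpolyXn.
Qed.

(** The coefficient is nonzero only if [s] together with some consecutive pair covers the cycle;
    this is how the cocycle condition is checked. *)
Lemma kd_fan_cochain s :
  kd pow_var fan_cochain s =
  (\sum_i altsign K (enum T) [:: i, ordS i & s])%:MP * 'X_[pow_exp s].
Proof.
rewrite kd_prod prod_pow_var -kd1_fan; congr (_ * _).
rewrite [RHS](rmorph_kd (@mpolyC n K)); apply: eq_kd_weight => j.
exact/esym/rmorph1.
Qed.

(* [mcoeff] at the exponents [pow_exp s + t] is a chain map to the simplicial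
   cochains, i.e. to the weights 1. *)
Lemma mcoeff_kd w s t :
  (kd pow_var w s)@_(pow_exp s + t) =
  kd (fun=> 1) (fun s' => (w s')@_(pow_exp s' + t)) s.
Proof.
elim: s w t => [|j s IH] w t /=; first by rewrite mcoeff0.
rewrite mcoeffB mul1r; congr (_ - _).
  by rewrite /pow_var mpolyXn mulrC pow_exp_cons -addmA mcoeffMX.
have -> : (pow_exp (j :: s) + t = pow_exp s + (U_(c j) *+ N + t))%MM.
  by rewrite pow_exp_cons addmA [(pow_exp _ + _)%MM]addmC.
rewrite IH; apply: eq_kd => s'; congr (mcoeff _ _).
by rewrite pow_exp_cons addmA [(pow_exp _ + _)%MM]addmC.
Qed.

(** A monomial [t] of [u] free of cycle variables exists. Coefficients at [pow_exp s + t] do not see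
    [J], so a multiple of [fan] by a nonzero scalar would agree with a simplicial coboundary on the
    faces of [r]. One more coboundary gives 0 on one side and that scalar on the other. *)
Lemma fan_cochain_not_bounding (J : R -> Prop) u w :
  (forall s f t, (size s <= k.+1)%N -> ord0 \notin s -> ordS ord0 \notin s ->
    avoids (mem (codom c)) t -> J f -> f@_(pow_exp s + t) = 0) ->
  ~ P u ->
  ~ (forall s, size s = k.+1 -> J (u * fan_cochain s - kd pow_var w s)).
Proof.
move=> J0 /not_var_prime[t tV ut] Jw.
have [r Er sz_r] := enum_ord2 k.
have : u@_t * kd (fun=> 1) (@fan K k) r != 0.
  by rewrite kd1_fan_top // mulr1.
apply/negP; rewrite negbK; apply/eqP.
rewrite -kdZ -[RHS](kd_kd (fun=> 1) (fun s => (w s)@_(pow_exp s + t)) r).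
apply: kd_ext => s sr; rewrite sz_r => -[sz_s].
have := enum_uniq T; rewrite Er /= inE negb_or => /andP[/andP[_ r0] /andP[r1 _]].
have s_notin j : j \notin r -> j \notin s by apply: contraNN; apply: mem_subseq.
rewrite -mcoeff_kd; apply/eqP; rewrite -subr_eq0; apply/eqP.
have := J0 s _ t _ (s_notin _ r0) (s_notin _ r1) tV (Jw s sz_s).
rewrite sz_s leqnn mcoeffB => /(_ isT) <-; congr (_ - _).
by rewrite /fan_cochain prod_pow_var mulrCA mcoeffCM mcoeffMX mulrC.
Qed.

End KoszulClass.

(** * Koszul vanishing for the localized quotient *)

Section RegularSequence.
Variables (K : fieldType) (n : nat) (T : finType).
Local Notation R := {mpoly K[n]}.

Lemma ideal_add_seq_step (J : R -> Prop) fs q x : (q < size fs)%N ->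
  ideal_add_seq J (take q.+1 fs) x ->
  exists r, ideal_add_seq J (take q fs) (x - fs`_q * r).
Proof.
move=> qs; have [I0 ID IM] : is_ideal (ideal_add_seq J (take q fs)).
  exact: ideal_gen_ideal.
apply: (ideal_gen_min (I := fun x => exists r,
  ideal_add_seq J (take q fs) (x - fs`_q * r))).
  split; first by exists 0; rewrite mulr0 subr0.
    move=> f g [r Ir] [r' Ir']; exists (r + r').
    by have := ID _ _ Ir Ir'; congr ideal_add_seq; ring.
  move=> h f [r Ir]; exists (h * r).
  by have := IM h _ Ir; congr ideal_add_seq; ring.
move=> g; rewrite (take_nth 0) // mem_rcons inE => -[Jg|/orP[/eqP ->|gq]].
- by exists 0; rewrite mulr0 subr0; apply: ideal_gen_incl; left.
- by exists 1; rewrite mulr1 subrr.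
- by exists 0; rewrite mulr0 subr0; apply: ideal_gen_incl; right.
Qed.

(** This is [koszul_vanishing] for the ideals generated by [J] and the first [q] entries of [fs],
    started at [q = 0], where the ideal is [J] itself. *)
Lemma regular_seq_vanishing (P J : R -> Prop) fs (y : T -> R) i z :
  is_prime P -> is_ideal J -> loc_regular_seq P J fs ->
  (forall f, P f -> exists M (g : T -> R), f ^+ M = \sum_j g j * y j) ->
  (i < size fs)%N ->
  (forall s, size s = i.+1 -> zero_loc P J (kd y z s)) ->
  exists u w, ~ P u /\ forall s, size s = i -> J (u * z s - kd y w s).
Proof.
move=> prP idJ [fsP [fs_reg _]] nilP ifs cz.
have J0 x : ideal_add_seq J (take 0 fs) x -> J x.
  by rewrite take0; apply: ideal_gen_min => // g [].
pose I q := ideal_add_seq J (take q fs).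
have idI q : is_ideal (I q) by apply: ideal_gen_ideal.
have JI q x : J x -> I q x by move=> Jx; apply: ideal_gen_incl; left.
have I_incl q x : (q < size fs)%N -> I q x -> I q.+1 x.
  move=> qs; apply: ideal_gen_min => // g [/JI //|gq]; apply: ideal_gen_incl; right.
  by rewrite (take_nth 0) // mem_rcons inE gq orbT.
have I_nth q : (q < size fs)%N -> I q.+1 fs`_q.
  by move=> qs; apply: ideal_gen_incl; right; rewrite (take_nth 0) // mem_rcons mem_head.
have I_nil q : (q < size fs)%N -> exists M (g : T -> R), fs`_q ^+ M = \sum_j g j * y j.
  by move=> qs; apply/nilP/fsP/mem_nth.
have [//|s /cz[v [Pv Jv]]|u [w [Pu Iw]]] := koszul_vanishing prP idI
    (@ideal_add_seq_step J fs) I_incl I_nth (fun q g qs => fs_reg q qs g) I_nil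
    (i := i) (m := 0) (z := z).
  by exists v; split=> //; apply: JI.
by exists u, w; split=> // s sz; apply/J0/Iw.
Qed.

End RegularSequence.

(** A cycle of length at least 4 has no triangle: [j] is not adjacent to 1 if it is the last vertex,
    and not to 0 otherwise. *)
Lemma cyc_nonadjacent k (j : 'I_k.+4) : j != ord0 -> j != ordS ord0 ->
  exists x y : 'I_k.+4, [/\ x \in [:: ord0; ordS ord0; j],
    y \in [:: ord0; ordS ord0; j], x != y & ~~ cyc_adj x y].
Proof.
move=> j0 j1; have vj0 : val j != 0%N by [].
have vj1 : val j != 1%N by [].
have [jk|jk] := eqVneq (val j) k.+3.
  exists (ordS ord0), j; split; rewrite ?inE ?eqxx ?orbT // 1?eq_sym //.
  by rewrite /cyc_adj jk /= modnn !modn_small.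
exists ord0, j; split; rewrite ?inE ?eqxx ?orbT // 1?eq_sym //.
rewrite /cyc_adj /= !modn_small ?(negbTE vj1) //.
by have := ltn_ord j; rewrite ltnS leq_eqVlt (negbTE jk).
Qed.

Theorem theorem5p7 (K : fieldType) (n : nat) (E : rel 'I_n) (w : 'I_n -> nat)
  (a : 'I_n -> nat) (S : seq (expv n)) :
  weighted_oriented E w ->
  lcm_min_gens (@edge_ideal K n E w) a ->
  irr_decomp (@edge_ideal K n E w) S ->
  cohen_macaulay_quot (@alexander_dual K n a S) ->
  chordal (compl_graph (underlying E)).
Proof.
move=> EwP aP SP CM [|[|[|[|k]]]] // c _ c_inj c_cyc.
case: (boolP [exists i, exists j,
  [&& i != j, ~~ cyc_adj i j & compl_graph (underlying E) (c i) (c j)]]).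
  by case/existsP=> i /existsP[j /and3P[]]; exists i, j.
rewrite negb_exists => /forallP chordless; exfalso.
(* Without chords in the complement, nonconsecutive cycle vertices are joined in the graph
   itself. *)
have c_edge x y : x != y -> ~~ cyc_adj x y -> underlying E (c x) (c y).
  move=> xy nxy; have := chordless x; rewrite negb_exists => /forallP/(_ y).
  by rewrite xy nxy /compl_graph (inj_eq c_inj) xy negbK.
pose J := @alexander_dual K n a S.
have idJ : is_ideal J by apply: ideal_gen_ideal.
have J_pair x y f : underlying E (c x) (c y) -> J f ->
    var_prime (pred2 (c x) (c y)) f.
  case/orP=> Exy /(alexander_dual_var_prime EwP aP SP Exy) //.
  by apply: var_prime_sub => v /=; rewrite orbC.
pose P := @var_prime K n (mem (codom c)).
have prP : is_prime P by apply: var_prime_prime.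
pose e2 : 'I_k.+4 := ordS (ordS ord0).
have v2 : val e2 = 2%N by [].
have E02 : underlying E (c ord0) (c e2).
  apply: c_edge; first by rewrite -val_eqE v2.
  by rewrite /cyc_adj v2.
have [|d [[[fs [sz_fs reg_fs]] _] [_ dim_le]]] := CM P prP.
  move=> f /(J_pair _ _ _ E02); apply: var_prime_sub => v /=.
  by case/orP => /eqP ->; apply: codom_f.
(* The cycle has [k.+4] vertices, so the chain has length [k.+2], one more than the degree [k.+1] of
   the fan class. *)
have k_lt : (k.+1 < size fs)%N.
  rewrite sz_fs; apply: dim_le; apply: (var_prime_chain c_inj (a := ord0) (b := e2)).
    by rewrite -val_eqE v2.
  by move=> f; apply: J_pair.
(* Any [N] above all [a v] works; it makes the powers exceed every dual exponent. *)
pose N := (\sum_v a v)%N.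
have aN v : (a v <= N)%N by rewrite /N (bigD1 v) //= leq_addr.
have nilP f : P f -> exists M (g : 'I_k.+4 -> {mpoly K[n]}),
    f ^+ M = \sum_j g j * pow_var K N c j.
  by apply: var_prime_nilpotent => v /codomP[j ->]; exists j.
have cocycle s : size s = k.+2 ->
    zero_loc P J (kd (pow_var K N c) (fan_cochain K N c) s).
  move=> sz_s; rewrite kd_fan_cochain.
  case: (pickP (fun i => altsign K (enum 'I_k.+4) [:: i, ordS i & s] != 0)) => [i nz|z].
    have si j : j \in [:: i, ordS i & s].
      by apply: altsign_neq0_mem nz _; rewrite mem_enum.
    (* Consecutive cycle vertices are adjacent in the complement, hence not joined in the graph. *)
    have [b bS [bi bi']] : exists2 b, b \in S & (b (c i) = 0 /\ b (c (ordS i)) = 0)%N.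
      apply: (independent_component EwP SP).
      have := c_cyc i (ordS i); rewrite /cyc_adj eqxx => /(_ isT).
      by case/andP.
    (* This monomial is a unit at [P]; it supplies the exponents needed outside the cycle. *)
    pose m := [multinom (if v \in codom c then 0 else N)%N | v < n].
    exists 'X_[m]; split.
      move/var_primeX/negP; apply; apply/avoidsP => v vc.
      by rewrite mnmE; move: vc => /= ->.
    rewrite mulrCA -mpolyXD; case: idJ => _ _ JM; apply: (JM).
    apply: (@alexander_dual_mono K n a S b) => // v bv; apply: leq_trans (aN v) _.
    rewrite mnmDE mnmE; case: ifPn => [/codomP[j vj]|_]; last exact: leq_addr.
    rewrite vj add0n; apply: pow_exp_in; move: (si j) bv; rewrite !inE vj.
    by case/or3P => [/eqP ->|/eqP ->|//]; rewrite ?bi ?bi' eqxx.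
  rewrite big1 ?mpolyC0 ?mul0r => [|i _]; last by apply/eqP/negbFE/z.
  by apply: zero_loc_incl => //; case: idJ.
have [u [h [Pu Jh]]] := regular_seq_vanishing prP idJ reg_fs nilP k_lt cocycle.
apply: (fan_cochain_not_bounding _ Pu Jh) => s f t sz_s s0 s1 tc Jf.
(* At most [k.+3] vertices are listed out of [k.+4]. The third missing vertex [j] yields a
   nonadjacent missing pair, that is, an edge of the graph on which the exponent vanishes. *)
have [j js] : exists j, j \notin [:: ord0, ordS ord0 & s].
  case: (pickP (fun j => j \notin [:: ord0, ordS ord0 & s])) => [j js|all_s].
    by exists j.
  have : (#|'I_k.+4| <= size [:: ord0, ordS ord0 & s])%N.
    apply: leq_trans (card_size _); apply: subset_leq_card.
    by apply/subsetP => j _; apply: negbFE (all_s j).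
  by rewrite card_ord /= !ltnS => /leq_trans/(_ sz_s); rewrite ltnn.
move: js; rewrite !inE !negb_or => /and3P[j0 j1 js].
have [x [y [xs ys xy nxy]]] := cyc_nonadjacent j0 j1.
have notin_s i : i \in [:: ord0; ordS ord0; j] -> i \notin s.
  by rewrite !inE => /or3P[]/eqP ->.
have /var_primeP := J_pair x y f (c_edge _ _ xy nxy) Jf; apply.
have t0 i : t (c i) = 0%N by apply: (avoidsP _ _ tc); apply: codom_f.
by apply/avoidsP => v /= /orP[]/eqP ->; rewrite mnmDE t0 pow_exp_notin ?notin_s.
Qed.
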